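(* Let $n\ge1$ and $0<s<\frac n2$. The space $H^s_{\mathcal D}(\mathbb R^n)$ is not an algebra under pointwise multiplication. In particular, let $\varepsilon_0=(0,1,\dots,1)\in\{0,1\}^n$, let $Q_k=[-2^{-k},0)^n\in\mathcal D$ for $k\ge0$, and let $\alpha$ satisfy $\frac sn<\alpha<\frac{s}{2n}+\frac14$. Then the function $$f:=\sum_{k=0}^\infty |Q_k|^\alpha\, h_{Q_k}^{\varepsilon_0}$$ belongs to $H^s_{\mathcal D}(\mathbb R^n)$, while $f^2\notin H^s_{\mathcal D}(\mathbb R^n)$.
   Context: $\mathbb R^n$ carries Lebesgue measure, denoted $|\cdot|$; functions are real-valued. $\mathcal D$ is the standard dyadic grid: all cubes $Q=I_1\times\dots\times I_n$ where $I_1,\dots,I_n$ are dyadic intervals $[2^k m,2^k(m+1))$, $m\in\mathbb Z$, of the same length $2^k$, $k\in\mathbb Z$. For a dyadic interval $I$ with left half $I_-$ and right half $I_+$ put $h_I^0=|I|^{-1/2}(\mathbf 1_{I_+}-\mathbf 1_{I_-})$ and $h_I^1=|I|^{-1/2}\mathbf 1_I$. For $Q=I_1\times\dots\times I_n\in\mathcal D$ and $\varepsilon\in\{0,1\}^n\setminus\{(1,\dots,1)\}$ put $h_Q^\varepsilon(x)=\prod_{i=1}^n h_{I_i}^{\varepsilon_i}(x_i)$; these Haar functions form an orthonormal basis of $L^2(\mathbb R^n)$. ''$\varepsilon\not\equiv 1$'' means $\varepsilon\neq(1,\dots,1)$. Write $(f,g)=\int_{\mathbb R^n}fg\,dx$.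 For $s>0$ the dyadic fractional derivative is $D^s_{\mathcal D}f=\sum_{Q\in\mathcal D,\ \varepsilon\not\equiv1}|Q|^{-s/n}(f,h_Q^\varepsilon)h_Q^\varepsilon$, and $H^s_{\mathcal D}(\mathbb R^n)=\{f\in L^2(\mathbb R^n): D^s_{\mathcal D}f\in L^2(\mathbb R^n)\}$, where $D^s_{\mathcal D}f\in L^2$ means $\sum_{Q\in\mathcal D,\ \varepsilon\not\equiv1}|Q|^{-2s/n}|(f,h_Q^\varepsilon)|^2<\infty$. A space of functions is an algebra if it is closed under pointwise multiplication. *)

(* Defs.v *)
From HB Require Import structures.
From mathcomp Require Import all_boot all_order all_algebra.
From mathcomp Require Import all_classical all_reals all_analysis.
Set Implicit Arguments.
Unset Strict Implicit.
Unset Printing Implicit Defensive.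
Import Order.TTheory GRing.Theory Num.Theory.
Import numFieldNormedType.Exports.
Local Open Scope classical_set_scope.
Local Open Scope ring_scope.

Notation Rn R n := (n.-tuple (measurableTypeR R)).

(** Lebesgue measure on [R^n] (with its Borel sigma-algebra), as the iterated
    product of the one-dimensional Lebesgue measure. *)

Definition tcons (R : realType) (n : nat) (p : measurableTypeR R * Rn R n) :
    Rn R n.+1 := [the n.+1.-tuple _ of p.1 :: p.2].

Lemma measurable_tcons (R : realType) (n : nat) :
  measurable_fun setT (@tcons R n).
Proof. exact: measurable_cons. Qed.

Section leb_succ.
Context (R : realType) (n : nat).
Variable mu : {sigma_finite_measure set (Rn R n) -> \bar R}.

Definition leb_succ : set (Rn R n.+1) -> \bar R :=
  pushforward (@lebesgue_measure R \x mu)%E (@tcons R n).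

Let leb_succ0 : leb_succ set0 = 0%E.
Proof. by rewrite /leb_succ /pushforward preimage_set0 measure0. Qed.

Let leb_succ_ge0 A : (0 <= leb_succ A)%E.
Proof. by rewrite /leb_succ /pushforward measure_ge0. Qed.

Let leb_succ_additive : semi_sigma_additive leb_succ.
Proof.
move=> F mF tF mUF; rewrite /leb_succ /pushforward preimage_bigcup.
have mp A : measurable A -> measurable (@tcons R n @^-1` A).
  by move=> mA; rewrite -[X in measurable X]setTI; exact: measurable_tcons.
apply: measure_semi_sigma_additive.
- by move=> k; exact: mp.
- apply/trivIsetP => /= i j _ _ ij; rewrite -preimage_setI.
  by move/trivIsetP : tF => /(_ _ _ _ _ ij) ->//; rewrite preimage_set0.
- by rewrite -preimage_bigcup; exact: mp.
Qed.

HB.instance Definition _ := isMeasure.Build _ _ _ leb_succ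
  leb_succ0 leb_succ_ge0 leb_succ_additive.

Let leb_succ_sigma_finite : sigma_finite setT leb_succ.
Proof.
have [F UF Ffin] : sigma_finite setT (@lebesgue_measure R \x mu)%E.
  have /sigma_finiteP[A [UA ndA Aoo]] := sigma_finiteT (@lebesgue_measure R).
  have /sigma_finiteP[B [UB ndB Boo]] := sigma_finiteT mu.
  exists (fun k => A k `*` B k).
    rewrite -setXTT UA UB predeqE => -[x y]; split.
      move=> [/= [i _ Aix] [j _ Bjy]]; exists (maxn i j) => //; split.
      - by move: x Aix; exact/subsetPset/ndA/leq_maxl.
      - by move: y Bjy; exact/subsetPset/ndB/leq_maxr.
    by move=> [k _ []/= ? ?]; split; exists k.
  move=> k; have [? ?] := Aoo k; have [? ?] := Boo k.
  split; first exact: measurableX.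
  by rewrite product_measure1E// lte_mul_pinfty// ge0_fin_numE.
pose unc (x : Rn R n.+1) : measurableTypeR R * Rn R n :=
  (thead x, [tuple of behead x]).
have munc : measurable_fun setT unc.
  apply/measurable_fun_pairP; split.
    by apply: (@measurable_tnth _ _ n.+1 ord0).
  exact: measurable_behead.
have tK : cancel (@tcons R n) unc.
  by move=> [x y]; rewrite /unc /tcons/=; congr pair; apply: val_inj.
exists (fun k => unc @^-1` F k).
  by rewrite -preimage_bigcup -UF preimage_setT.
move=> k; have [mF Fk] := Ffin k; split.
  by rewrite -[X in measurable X]setTI; exact: munc.
rewrite /leb_succ /pushforward -comp_preimage.
suff -> : unc \o @tcons R n = id by [].
by apply/funext => p /=; rewrite tK.
Qed.

HB.instance Definition _ := Measure_isSigmaFinite.Build _ _ _ leb_succ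
  leb_succ_sigma_finite.

End leb_succ.

Fixpoint leb (R : realType) (n : nat) :
    {sigma_finite_measure set (Rn R n) -> \bar R} :=
  match n return {sigma_finite_measure set (Rn R n) -> \bar R} with
  | 0%N => \d_([tuple] : Rn R 0)
  | k.+1 => leb_succ (leb R k)
  end.

Definition box (R : realType) (n : nat) (A : 'I_n -> set R) : set (Rn R n) :=
  [set x | forall i, A i (tnth x i)].

Lemma leb_box (R : realType) (n : nat) (A : 'I_n -> set R) :
  (forall i, measurable (A i : set (measurableTypeR R))) ->
  leb R n (box A) = (\prod_(i < n) @lebesgue_measure R (A i))%E.
Proof.
elim: n A => [|n IH] A mA /=.
  rewrite big_ord0 diracE; case: (boolP (_ \in _)) => //.
  by rewrite notin_setE => /(_ _)[]; case.
have mB : measurable (box (fun i => A (lift ord0 i))).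
  rewrite (_ : box _ = \bigcap_(i in [set: 'I_n])
    ((fun x : Rn R n => tnth x i) @^-1` A (lift ord0 i))).
    apply: fin_bigcap_measurable => [|i _]; first exact: finite_finset.
    rewrite -[X in measurable X]setTI.
    exact: (@measurable_tnth _ (measurableTypeR R) n i).
  by apply/seteqP; split=> x /= h i; [move=> _|]; apply: h.
rewrite big_ord_recl -IH// -product_measure1E//.
rewrite /leb_succ /pushforward; congr (_ _).
apply/seteqP; split=> -[x y] /=.
  move=> h; split; first exact: (h ord0).
  by move=> i /=; have := h (lift ord0 i); rewrite tnthS.
move=> [hx hy] i; case: (unliftP ord0 i) => [j ->|->]; last exact: hx.
by rewrite tnthS; exact: hy.
Qed.

(** The interval [[2^k m, 2^k (m+1))]; its left and right halves are the
    dyadic intervals [(k - 1, 2m)] and [(k - 1, 2m + 1)]. *)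
Definition dyadic_interval (R : realType) (k m : int) : set R :=
  `[2%:R ^ k * m%:~R, 2%:R ^ k * (m + 1)%:~R[%classic.
Arguments dyadic_interval R k m : clear implicits.

Definition ilen (R : realType) (I : set R) : R := fine (@lebesgue_measure R I).

(** [haar1 false k m] is the function h^0 and [haar1 true k m] the function
    h^1 of the dyadic interval [dyadic_interval k m]. *)
Definition haar1 (R : realType) (e : bool) (k m : int) (x : R) : R :=
  ilen (dyadic_interval R k m) `^ (- 2^-1) *
  (if e then \1_(dyadic_interval R k m) x
   else \1_(dyadic_interval R (k - 1) (2 * m + 1)) x
        - \1_(dyadic_interval R (k - 1) (2 * m)) x).

(** A dyadic cube of [R^n] is coded by the exponent [k] of its common side
    length [2^k] and the positions [m_1, ..., m_n] of its sides.  For [0 < n]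
    this coding is a bijection onto the dyadic grid. *)
Notation dcube n := (int * {ffun 'I_n -> int})%type.

Definition cube_set (R : realType) (n : nat) (Q : dcube n) : set (Rn R n) :=
  box (fun i => dyadic_interval R Q.1 (Q.2 i)).
Arguments cube_set R {n} Q.

Definition vol (R : realType) (n : nat) (Q : dcube n) : R :=
  fine (leb R n (cube_set R Q)).

Definition haar (R : realType) (n : nat) (Q : dcube n)
    (e : {ffun 'I_n -> bool}) (x : Rn R n) : R :=
  \prod_(i < n) haar1 (e i) Q.1 (Q.2 i) (tnth x i).

Definition inner (R : realType) (n : nat) (f g : Rn R n -> R) : R :=
  \int[leb R n]_x (f x * g x).

(** The index set of the Haar basis: all pairs of a dyadic cube and a
    signature different from [(1, ..., 1)]. *)
Definition haar_index (n : nat) : set (dcube n * {ffun 'I_n -> bool}) :=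
  [set p | p.2 != [ffun => true]].

(** The squared L^2 norm of [D^s f], where
    [D^s f = \sum_(Q, e) |Q|^(- s / n) (f, h_Q^e) h_Q^e], is by definition the
    sum, possibly infinite, of its squared Haar coefficients. *)
Definition dyadic_energy (R : realType) (n : nat) (s : R) (f : Rn R n -> R) :
    \bar R :=
  (\esum_(p in @haar_index n)
     (vol R p.1 `^ (- (2 * s / n%:R)) * `|inner f (haar p.1 p.2)| ^+ 2)%:E)%E.

(** The elements of the space are everywhere defined representatives,
    measurable for the Borel sigma-algebra; membership only depends on the
    almost everywhere class of such a representative. *)
Definition dyadic_sobolev (R : realType) (n : nat) (s : R) :
    set (Rn R n -> R) :=
  [set f | f \in Lfun (leb R n) 2%:E /\ (dyadic_energy s f < +oo)%E].

Definition is_algebra (R : realType) (T : Type) (S : set (T -> R)) : Prop :=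
  forall f g, S f -> S g -> S (f \* g).

Definition eps0 (n : nat) : {ffun 'I_n -> bool} :=
  [ffun i : 'I_n => nat_of_ord i != 0%N].

(** The cube [[-2^-k, 0)^n]. *)
Definition corner_cube (n : nat) (k : nat) : dcube n :=
  (- k%:Z, [ffun => -1]).

(** The series is taken pointwise; each point lies in only finitely many of
    the cubes, so its partial sums are eventually constant. *)
Definition corner_fun (R : realType) (n : nat) (alpha : R) (x : Rn R n) : R :=
  limn (fun N : nat => \sum_(0 <= k < N)
    vol R (corner_cube n k) `^ alpha * haar (corner_cube n k) (eps0 n) x).

(* Main.v *)
Require Import Defs.
From mathcomp Require Import all_boot all_order all_algebra.
From mathcomp Require Import all_classical all_reals all_analysis.
From mathcomp Require Import measurable_realfun.
From mathcomp Require Import ring lra zify.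
Import Order.TTheory GRing.Theory Num.Theory.
Import numFieldNormedType.Exports.
Local Open Scope classical_set_scope.
Local Open Scope ring_scope.

Set Implicit Arguments.
Unset Strict Implicit.
Unset Printing Implicit Defensive.

(** Write [v_k = |Q_k| = 2^(- n k)], let [h_k] be the Haar function of the corner
    cube [Q_k] with signature [(0, 1, ..., 1)], so that [f] is the sum of the
    [v_k^alpha h_k].

    The Haar functions are orthonormal ([inner_haar_sqr], [inner_haar_neq]), and
    [f] is the limit of its partial sums in a sense strong enough to compute its
    Haar coefficients ([inner_corner_sum_cvg], by dominated convergence): they
    are [v_k^alpha] on [h_k] and zero elsewhere.  The energy of [f] is thus the
    geometric series of the [v_k^(2 alpha - 2 s / n)], finite because
    [s / n < alpha]; the same argument without the weight puts [f] in [L^2]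
    (by Fatou, [integrable_corner_fun_sqr]).

    The reason why squaring destroys regularity is that all the coarser functions
    [h_j], [j < m], are constant and positive on [Q_m], since [Q_m] lies in the
    right half of [Q_j].  On the left half of [Q_m] the finer functions vanish,
    and [f] is the constant [c - a], where [a = v_m^(alpha - 1/2)] and
    [c] is the sum of the [v_j^(alpha - 1/2)] for [j < m].  On the right half,
    [f] is [c + a] plus finer functions of mean zero, so that by Jensen its
    square has mean at least [(c + a)^2].  Hence [(f^2, h_m)] is at least
    [2 v_m^alpha c] ([inner_corner_fun_sqr_ge]).  Keeping only the last term of
    [c] bounds [(f^2, h_m)] from below by a constant times [v_m^(2 alpha - 1/2)],
    and, up to a constant, the energy of [f^2] dominates the sum of the
    [v_m^(4 alpha - 1 - 2 s / n)].  For [alpha <= s / (2 n) + 1 / 4] these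
    exponents are at most zero, the terms do not tend to zero, and the energy is
    infinite ([corner_fun_sqr_energy]).

    The interval of admissible [alpha] is nonempty exactly when [s < n / 2], and
    then [f] itself witnesses that the space is not an algebra. *)

(** * Integrals of tensor products *)

Lemma integrable_tensor d1 d2 (T1 : measurableType d1) (T2 : measurableType d2)
    (R : realType) (m1 : {sigma_finite_measure set T1 -> \bar R})
    (m2 : {sigma_finite_measure set T2 -> \bar R}) (f : T1 -> R) (g : T2 -> R) :
  m1.-integrable setT (EFin \o f) -> m2.-integrable setT (EFin \o g) ->
  (m1 \x m2)%E.-integrable setT (fun z => (f z.1 * g z.2)%:E).
Proof.
move=> intf intg.
have mf : measurable_fun setT f by apply/measurable_EFinP; case/integrableP: intf.
have mg : measurable_fun setT g by apply/measurable_EFinP; case/integrableP: intg.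
have mfg : measurable_fun setT (fun z : T1 * T2 => (f z.1 * g z.2)%:E).
  apply/measurable_EFinP; apply: measurable_funM.
  - exact: measurableT_comp mf measurable_fst.
  - exact: measurableT_comp mg measurable_snd.
apply/(integrable12ltyP _ _ mfg) => /=.
under eq_integral => x _.
  under eq_integral => y _ do rewrite normrM EFinM.
  rewrite ge0_integralZl//; last exact/measurable_EFinP/measurableT_comp.
  over.
rewrite ge0_integralZr//.
- rewrite lte_mul_pinfty//.
  + exact: integral_ge0.
  + by rewrite ge0_fin_numE; [case/integrableP: intf|exact: integral_ge0].
  + by case/integrableP: intg.
- exact/measurable_EFinP/measurableT_comp.
- exact: integral_ge0.
Qed.

Lemma integral_tensor d1 d2 (T1 : measurableType d1) (T2 : measurableType d2)
    (R : realType) (m1 : {sigma_finite_measure set T1 -> \bar R})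
    (m2 : {sigma_finite_measure set T2 -> \bar R}) (f : T1 -> R) (g : T2 -> R) :
  m1.-integrable setT (EFin \o f) -> m2.-integrable setT (EFin \o g) ->
  (\int[m1 \x m2]_z (f z.1 * g z.2)%:E =
   (\int[m1]_x f x * \int[m2]_y g y)%:E)%E.
Proof.
move=> intf intg.
rewrite -(integral12_prod_meas1 (integrable_tensor intf intg)) /fubini_F /=.
under eq_integral => x _.
  under eq_integral => y _ do rewrite EFinM.
  rewrite integralZl//.
  rewrite -[X in (_ * X)%E]fineK; last exact: integrable_fin_num.
  over.
rewrite /= integralZr//.
by rewrite -[X in (X * _)%E]fineK// integrable_fin_num.
Qed.

(** Fubini along the recursive construction of [leb].  Every integral of Haar
    functions below reduces to one-dimensional ones through this identity. *)
Lemma leb_prod (R : realType) (n : nat) (g : 'I_n -> R -> R) :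
  (forall i, (@lebesgue_measure R).-integrable setT (EFin \o g i)) ->
  (leb R n).-integrable setT (EFin \o fun x => \prod_(i < n) g i (tnth x i)) /\
  \int[leb R n]_x (\prod_(i < n) g i (tnth x i)) =
  \prod_(i < n) \int[@lebesgue_measure R]_t g i t.
Proof.
elim: n g => [|n IH] g intg.
  have E : EFin \o (fun x : Rn R 0 => \prod_(i < 0) g i (tnth x i)) = cst 1%E.
    by apply/funext => x /=; rewrite big_ord0.
  have leb0 : leb R 0 setT = 1%E by rewrite /= diracE in_setT.
  split; last first.
    rewrite /Rintegral.
    rewrite (eq_integral (cst 1%E)); last by move=> x _ /=; rewrite big_ord0.
    by rewrite big_ord0 integral_cst// [X in (_ * X)%E]leb0 mule1.
  rewrite E; apply/integrableP; split; first exact: measurable_cst.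
  under eq_integral do rewrite /= normr1.
  by rewrite integral_cst// [X in (_ * X)%E]leb0 mule1 ltry.
have [intP valP] := IH (fun i => g (lift ord0 i)) (fun i => intg _).
set P := (fun x => _) in intP.
have mG : measurable_fun setT (EFin \o fun x : Rn R n.+1 =>
    \prod_(i < n.+1) g i (tnth x i)).
  apply/measurable_EFinP; apply: measurable_prod => i _.
  apply: (@measurableT_comp _ _ _ _ _ _ (g i) _ (fun x : Rn R n.+1 => tnth x i)).
    by apply/measurable_EFinP; case/integrableP: (intg i).
  exact: (@measurable_tnth _ (measurableTypeR R) n.+1 i).
have E : (EFin \o fun x : Rn R n.+1 => \prod_(i < n.+1) g i (tnth x i))
    \o @tcons R n = fun z => (g ord0 z.1 * P z.2)%:E.
  apply/funext => z /=; rewrite big_ord_recl; congr (_ * _)%:E.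
  by apply: eq_bigr => i _; rewrite tnthS.
have int2 : (lebesgue_measure \x leb R n)%E.-integrable
    (@tcons R n @^-1` setT)
    ((EFin \o fun x : Rn R n.+1 => \prod_(i < n.+1) g i (tnth x i))
       \o @tcons R n).
  by rewrite preimage_setT E; exact: integrable_tensor.
split; first exact: (integrable_pushforward (@measurable_tcons R n) mG int2).
rewrite /Rintegral.
rewrite (integral_pushforward (@measurable_tcons R n) mG int2)//.
by rewrite preimage_setT E integral_tensor//= big_ord_recl -valP.
Qed.

(** * Dyadic intervals *)

Section OneDimension.
Context (R : realType).
Implicit Types (k m : int) (e : bool) (x y : R).
Notation I k m := (dyadic_interval R k m).
Notation lambda := (@lebesgue_measure R).

Lemma dyadic_intervalE k m x :
  I k m x <-> 2%:R ^ k * m%:~R <= x < 2%:R ^ k * (m + 1)%:~R.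
Proof. by rewrite /dyadic_interval /= in_itv. Qed.

Lemma exp2z_gt0 k : 0 < 2%:R ^ k :> R.
Proof. by rewrite exprz_gt0. Qed.

Lemma measurable_dyadic k m : measurable (I k m : set (measurableTypeR R)).
Proof. exact: measurable_itv. Qed.

Lemma lebesgue_dyadic k m : lambda (I k m) = (2%:R ^ k)%:E.
Proof.
rewrite lebesgue_measure_itv /= lte_fin ltr_pM2l ?exp2z_gt0// ltr_int ltzD1 lexx.
by rewrite -EFinB rmorphD/= mulrDr mulr1 addrAC subrr add0r.
Qed.

Lemma ilen_dyadic k m : ilen (I k m) = 2%:R ^ k.
Proof. by rewrite /ilen lebesgue_dyadic. Qed.

(** Dyadic intervals are nested or disjoint: the endpoints of the longer interval
    are integer multiples of the length of the shorter one, so none of them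
    falls strictly inside it. *)
Lemma dyadic_nested k m k' m' x y : k <= k' ->
  I k m x -> I k m y -> I k' m' x -> I k' m' y.
Proof.
move=> kk'; have [j ->] : exists j : nat, k' = k + j%:Z.
  by exists `|k' - k|%N; lia.
rewrite !dyadic_intervalE expfzDr ?pnatr_eq0// -!mulrA.
have -> : 2%:R ^ j%:Z = (2 ^ j)%:~R :> R by rewrite rmorphXn.
rewrite -!intrM => /andP[mx xm] /andP[my ym] /andP[m'x xm'].
have lo : 2 ^ j * m' <= m.
  by rewrite -ltzD1 -(ltr_int R) -(ltr_pM2l (exp2z_gt0 k)) (le_lt_trans m'x).
have hi : m + 1 <= 2 ^ j * (m' + 1).
  by rewrite lezD1 -(ltr_int R) -(ltr_pM2l (exp2z_gt0 k)) (le_lt_trans mx).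
rewrite (le_trans _ my) ?(lt_le_trans ym)//.
  by rewrite ler_pM2l ?exp2z_gt0// ler_int.
by rewrite ler_pM2l ?exp2z_gt0// ler_int.
Qed.

Lemma dyadic_disjoint k m m' x : I k m x -> I k m' x -> m = m'.
Proof.
rewrite !dyadic_intervalE => /andP[mx xm] /andP[m'x xm'].
have /= := le_lt_trans mx xm'; rewrite ltr_pM2l ?exp2z_gt0// ltr_int ltzD1.
have /= := le_lt_trans m'x xm; rewrite ltr_pM2l ?exp2z_gt0// ltr_int ltzD1.
by move=> ? ?; apply/eqP; rewrite eq_le; apply/andP.
Qed.

Lemma dyadic_halves k m x :
  I k m x <-> I (k - 1) (2 * m) x \/ I (k - 1) (2 * m + 1) x.
Proof.
rewrite !dyadic_intervalE expfzDr ?pnatr_eq0// exprN1 -!mulrA.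
have h2 a : 2^-1 * (2 * a)%:~R = a%:~R :> R.
  by rewrite intrM mulrA mulVf ?mul1r// pnatr_eq0.
have -> : 2 * m + 1 + 1 = 2 * (m + 1) by rewrite mulrDr mulr1 -addrA.
rewrite !h2; have p := exp2z_gt0 k; set c := (X in 2 ^ k * X) in |- *.
have c1 : m%:~R <= 2^-1 * (2 * m + 1)%:~R :> R.
  by rewrite rmorphD /= mulrDr h2; lra.
have c2 : 2^-1 * (2 * m + 1)%:~R <= (m + 1)%:~R :> R.
  by rewrite !rmorphD /= mulrDr h2; lra.
split=> [/andP[a b]|].
  by case: (ltP x (2 ^ k * (2^-1 * (2 * m + 1)%:~R))) => ?; [left|right]; apply/andP.
case=> /andP[a b]; apply/andP; split=> //.
  by apply: (lt_le_trans b); rewrite ler_pM2l.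
by apply: le_trans a; rewrite ler_pM2l.
Qed.

Lemma dyadic_half_disj k m x : I (k - 1) (2 * m) x -> I (k - 1) (2 * m + 1) x -> False.
Proof. by move=> /dyadic_disjoint h /h; lia. Qed.

End OneDimension.

(** * Haar functions on the line *)

Section Haar1.
Context (R : realType).
Implicit Types (k m : int) (e : bool) (x y : R).
Notation I k m := (dyadic_interval R k m).
Notation lambda := (@lebesgue_measure R).

Definition haar1_height k : R := (2%:R ^ k) `^ (- 2^-1).

Lemma haar1_height_gt0 k : 0 < haar1_height k.
Proof. by rewrite powR_gt0// exp2z_gt0. Qed.

Lemma haar1_height_sqr k : haar1_height k ^+ 2 = (2%:R ^ k)^-1.
Proof.
rewrite expr2 -powRD; last by rewrite (gt_eqF (exp2z_gt0 _ _)) implybT.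
have -> : - 2^-1 + - 2^-1 = -1 :> R by lra.
by rewrite powR_inv1// ltW// exp2z_gt0.
Qed.

Lemma haar1_out e k m x : ~ I k m x -> haar1 e k m x = 0.
Proof.
move=> nI; rewrite /haar1 !indicE !memNset ?subrr ?if_same ?mulr0//.
  by move=> h; apply/nI/dyadic_halves; left.
by move=> h; apply/nI/dyadic_halves; right.
Qed.

Lemma haar1_true k m x : I k m x -> haar1 true k m x = haar1_height k.
Proof. by move=> Ix; rewrite /haar1 ilen_dyadic indicE mem_set ?mulr1. Qed.

Lemma haar1_right k m x : I (k - 1) (2 * m + 1) x ->
  haar1 false k m x = haar1_height k.
Proof.
move=> Ix; rewrite /haar1 ilen_dyadic !indicE mem_set// memNset ?subr0 ?mulr1//.
by move=> /dyadic_half_disj/(_ Ix).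
Qed.

Lemma haar1_left k m x : I (k - 1) (2 * m) x ->
  haar1 false k m x = - haar1_height k.
Proof.
move=> Ix; rewrite /haar1 ilen_dyadic !indicE (mem_set Ix) memNset ?sub0r ?mulrN1//.
by move=> /(dyadic_half_disj Ix).
Qed.

Lemma haar1_sqr e k m x : haar1 e k m x ^+ 2 = (2%:R ^ k)^-1 * \1_(I k m) x.
Proof.
rewrite indicE; case: (pselect (I k m x)) => [Ix|nIx]; last first.
  by rewrite haar1_out// memNset// expr0n/= mulr0.
rewrite mem_set// mulr1 -haar1_height_sqr; case: e; first by rewrite haar1_true.
by case/dyadic_halves: Ix => [/haar1_left->|/haar1_right->]; rewrite ?sqrrN.
Qed.

Lemma haar1_bound e k m x : `|haar1 e k m x| <= haar1_height k.
Proof.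
have h0 := ltW (haar1_height_gt0 k); have p0 := ltW (exp2z_gt0 R k).
rewrite -ler_sqr ?nnegrE// real_normK ?num_real//.
by rewrite haar1_sqr haar1_height_sqr ler_piMr ?invr_ge0//.
Qed.

(** The indicators entering the definition of a Haar function of a longer
    interval are those of the interval or of its halves, which are still at least
    as long as [I k m]; by nesting each of these intervals contains [I k m] or
    misses it.
    The function with [e = true] does not involve the halves, whence the extra
    case of equal lengths. *)
Lemma haar1_const e k m k' m' x y : (k < k') || (k == k') && e ->
  I k m x -> I k m y -> haar1 e k' m' x = haar1 e k' m' y.
Proof.
move=> kk' Ix Iy.
have ind k'' m'' : k <= k'' -> \1_(I k'' m'') x = \1_(I k'' m'') y :> R.
  move=> kk''; rewrite !indicE; congr (nat_of_bool _)%:R.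
  by apply/idP/idP => /[!inE]; [move/(dyadic_nested kk'' Ix Iy)|move/(dyadic_nested kk'' Iy Ix)].
rewrite /haar1; congr (_ * _); case: e kk' => kk'; first by rewrite ind//; lia.
by rewrite !ind//; lia.
Qed.

Lemma measurable_haar1 e k m :
  measurable_fun setT (haar1 e k m : measurableTypeR R -> R).
Proof.
apply: measurable_funM => //; case: e.
  by apply: measurable_indic; exact: measurable_dyadic.
by apply: measurable_funB; apply: measurable_indic; exact: measurable_dyadic.
Qed.

Lemma integrable_dyadic k m : lambda.-integrable setT (EFin \o \1_(I k m)).
Proof. exact: integrable_indic_itv. Qed.

Lemma Rintegral_dyadic k m : \int[lambda]_x \1_(I k m) x = 2%:R ^ k.
Proof.
rewrite /Rintegral integral_indic//; last exact: measurable_dyadic.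
by rewrite setIT; exact: ilen_dyadic.
Qed.

Lemma integrable_haar1 e k m : lambda.-integrable setT (EFin \o haar1 e k m).
Proof.
case: e.
  have -> : EFin \o haar1 true k m =
      (fun x => (ilen (I k m) `^ (- 2^-1))%:E * (EFin \o \1_(I k m)) x)%E by [].
  by apply: integrableZl => //; exact: integrable_dyadic.
have -> : EFin \o haar1 false k m =
  (fun x => (ilen (I k m) `^ (- 2^-1))%:E *
   ((EFin \o \1_(I (k - 1) (2 * m + 1))) \- (EFin \o \1_(I (k - 1) (2 * m)))) x)%E.
  by [].
by apply: integrableZl => //; apply: integrableB => //; exact: integrable_dyadic.
Qed.

Lemma Rintegral_haar1_false k m : \int[lambda]_x haar1 false k m x = 0.
Proof.
rewrite RintegralZl//; last first.
  have -> : (EFin \o fun x => \1_(I (k - 1) (2 * m + 1)) x - \1_(I (k - 1) (2 * m)) x)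
    = ((EFin \o \1_(I (k - 1) (2 * m + 1))) \- (EFin \o \1_(I (k - 1) (2 * m))))%E by [].
  by apply: integrableB => //; exact: integrable_dyadic.
by rewrite RintegralB ?Rintegral_dyadic ?subrr ?mulr0//; exact: integrable_dyadic.
Qed.

Lemma integrable_haar1M e k m e' k' m' :
  lambda.-integrable setT (EFin \o fun x => haar1 e k m x * haar1 e' k' m' x).
Proof.
have -> : EFin \o (fun x => haar1 e k m x * haar1 e' k' m' x) =
  ((EFin \o haar1 e k m) \* (EFin \o haar1 e' k' m'))%E by [].
apply: integrableMr => //; [exact: measurable_haar1| |exact: integrable_haar1].
exists (haar1_height k); split; first exact: num_real.
by move=> M kM x _ /=; rewrite (le_trans (haar1_bound _ _ _ _))// ltW.
Qed.

Lemma Rintegral_haar1_sqr e k m :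
  \int[lambda]_x (haar1 e k m x * haar1 e k m x) = 1.
Proof.
under eq_Rintegral do rewrite -expr2 haar1_sqr.
rewrite RintegralZl ?Rintegral_dyadic ?mulVf ?gt_eqF ?exp2z_gt0//.
exact: integrable_dyadic.
Qed.

Lemma Rintegral_haar1_disj e e' k m m' : m <> m' ->
  \int[lambda]_x (haar1 e k m x * haar1 e' k m' x) = 0.
Proof.
move=> mm'; under eq_Rintegral => x _.
  have -> : haar1 e k m x * haar1 e' k m' x = 0.
    case: (pselect (I k m x)) => [Ix|/haar1_out ->]; last by rewrite mul0r.
    by rewrite [X in _ * X]haar1_out ?mulr0// => /(dyadic_disjoint Ix).
  over.
by rewrite Rintegral_cst ?mul0r.
Qed.

(** The mean-zero function of an interval sees a constant factor only. *)
Lemma Rintegral_haar1_const e k m k' m' : (k < k') || (k == k') && e ->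
  \int[lambda]_x (haar1 false k m x * haar1 e k' m' x) = 0.
Proof.
move=> kk'.
have [x0 Ix0] : exists x0, I k m x0.
  exists (2%:R ^ k * m%:~R); apply/dyadic_intervalE; rewrite lexx /=.
  by rewrite ltr_pM2l ?exp2z_gt0// ltr_int ltzD1.
under eq_Rintegral => x _.
  have -> : haar1 false k m x * haar1 e k' m' x = haar1 false k m x * haar1 e k' m' x0.
    case: (pselect (I k m x)) => [Ix|/haar1_out ->]; last by rewrite !mul0r.
    by congr (_ * _); exact: haar1_const Ix Ix0.
  over.
rewrite RintegralZr ?Rintegral_haar1_false ?mul0r//; exact: integrable_haar1.
Qed.

End Haar1.

(** * The Haar system of the space *)

Section HaarSystem.
Context (R : realType) (n : nat).
Implicit Types (Q : dcube n) (e : {ffun 'I_n -> bool}) (x : Rn R n).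

Lemma vol_dcube Q : vol R Q = (2%:R ^ Q.1) ^+ n.
Proof.
rewrite /vol /cube_set leb_box; last by move=> i; exact: measurable_dyadic.
under eq_bigr do rewrite lebesgue_dyadic.
by rewrite prodEFin /= prodr_const card_ord.
Qed.

Lemma vol_gt0 Q : 0 < vol R Q.
Proof. by rewrite vol_dcube exprn_gt0// exp2z_gt0. Qed.

Lemma haar_height Q : haar1_height R Q.1 ^+ n = vol R Q `^ (- 2^-1).
Proof.
rewrite vol_dcube /haar1_height; set a := 2 ^ _.
have a0 : 0 <= a by exact: ltW (exp2z_gt0 R Q.1).
by rewrite -powR_mulrn ?powR_ge0// -(powR_mulrn n a0) -!powRrM mulrC.
Qed.

Lemma haar_out Q e x : ~ cube_set R Q x -> haar Q e x = 0.
Proof.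
move=> /existsNP[i nI]; rewrite /haar (bigD1 i)//= haar1_out ?mul0r//.
Qed.

Lemma haar_bound Q e x : `|haar Q e x| <= vol R Q `^ (- 2^-1).
Proof.
rewrite /haar normr_prod -haar_height -[X in _ ^+ X]card_ord -prodr_const.
by apply: ler_prod => i _; rewrite normr_ge0 haar1_bound.
Qed.

Lemma measurable_haar Q e : measurable_fun setT (@haar R n Q e).
Proof.
apply: measurable_prod => i _.
apply: (@measurableT_comp _ _ _ _ _ _ (haar1 (e i) Q.1 (Q.2 i) : measurableTypeR R -> R)
  _ (fun x : Rn R n => tnth x i)); first exact: measurable_haar1.
exact: (@measurable_tnth _ (measurableTypeR R) n i).
Qed.

Lemma integrableM_haar Q e (f : Rn R n -> R) :
  (leb R n).-integrable setT (EFin \o f) ->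
  (leb R n).-integrable setT (EFin \o fun x => f x * haar Q e x).
Proof.
move=> intf.
have -> : EFin \o (fun x => f x * haar Q e x) =
  ((EFin \o f) \* (EFin \o haar Q e))%E by [].
apply: integrableMl => //; first exact: measurable_haar.
exists (vol R Q `^ (- 2^-1)); split; first exact: num_real.
by move=> M kM x _ /=; rewrite (le_trans (haar_bound _ _ _))// ltW.
Qed.

Lemma integrable_haar Q e : (leb R n).-integrable setT (EFin \o haar Q e).
Proof.
by have [] := leb_prod (fun i => integrable_haar1 R (e i) Q.1 (Q.2 i)).
Qed.

Lemma haar_index_false (p : dcube n * {ffun 'I_n -> bool}) :
  haar_index p -> exists i, p.2 i = false.
Proof.
move=> /eqP pT; apply/not_existsP => allt; apply: pT; apply/ffunP => i.
by rewrite ffunE; move: (allt i); case: (p.2 i).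
Qed.

Lemma Rintegral_haar Q e : haar_index (Q, e) -> \int[leb R n]_x haar Q e x = 0.
Proof.
move=> /haar_index_false[i /= ei].
have [_ ->] := leb_prod (fun i => integrable_haar1 R (e i) Q.1 (Q.2 i)).
by rewrite (bigD1 i)//= ei Rintegral_haar1_false mul0r.
Qed.

Lemma innerC (f g : Rn R n -> R) : inner f g = inner g f.
Proof. by rewrite /inner; under eq_Rintegral do rewrite mulrC. Qed.

Lemma inner_haar_prod Q e Q' e' : inner (@haar R n Q e) (haar Q' e') =
  \prod_(i < n) \int[@lebesgue_measure R]_t
    (haar1 (e i) Q.1 (Q.2 i) t * haar1 (e' i) Q'.1 (Q'.2 i) t).
Proof.
have [_ <-] := leb_prod (fun i =>
  integrable_haar1M R (e i) Q.1 (Q.2 i) (e' i) Q'.1 (Q'.2 i)).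
by rewrite /inner; apply: eq_Rintegral => x _; rewrite /haar -big_split.
Qed.

Lemma inner_haar_sqr Q e : inner (@haar R n Q e) (haar Q e) = 1.
Proof. by rewrite inner_haar_prod big1// => i _; exact: Rintegral_haar1_sqr. Qed.

Lemma inner_haar_shorter Q e Q' e' : haar_index (Q, e) -> Q.1 < Q'.1 ->
  inner (@haar R n Q e) (haar Q' e') = 0.
Proof.
move=> /haar_index_false[i /= ei] lt; rewrite inner_haar_prod (bigD1 i)//= ei.
by rewrite Rintegral_haar1_const ?lt// mul0r.
Qed.

(** One coordinate suffices to make the product of integrals vanish: a coordinate
    in which the shorter cube carries the mean-zero function, or, for equal side
    lengths, one in which the positions or the signatures differ. *)
Lemma inner_haar_neq Q e Q' e' : haar_index (Q, e) -> haar_index (Q', e') ->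
  (Q, e) <> (Q', e') -> inner (@haar R n Q e) (haar Q' e') = 0.
Proof.
move=> he he' neq; case: (ltgtP Q.1 Q'.1) => [lt|gt|eqk].
- exact: inner_haar_shorter.
- by rewrite innerC inner_haar_shorter.
rewrite inner_haar_prod.
have [eqm|/eqP neqm] := eqVneq Q.2 Q'.2; last first.
  have [i neqi] : exists i, Q.2 i <> Q'.2 i.
    by apply/existsNP => eqi; apply: neqm; apply/ffunP.
  by rewrite (bigD1 i)//= -eqk Rintegral_haar1_disj ?mul0r.
have [i neqi] : exists i, e i <> e' i.
  apply/existsNP => eqi; apply: neq; congr pair; last exact/ffunP.
  by move: eqk eqm; case: (Q) => a b; case: (Q') => c d /= -> ->.
rewrite (bigD1 i)//= -eqk -eqm.
case: (e i) (e' i) neqi => -[] // _.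
  under eq_Rintegral do rewrite mulrC.
  by rewrite Rintegral_haar1_const ?eqxx ?orbT// mul0r.
by rewrite Rintegral_haar1_const ?eqxx ?orbT// mul0r.
Qed.

End HaarSystem.

(** * The corner cubes and their Haar functions *)

Section Corner.
Context (R : realType) (n : nat).
Implicit Types (k j m N : nat) (x : Rn R n.+1).

Definition corner_vol k : R := vol R (corner_cube n.+1 k).
Definition corner_haar k : Rn R n.+1 -> R := haar (corner_cube n.+1 k) (eps0 n.+1).
Definition corner_height k : R := corner_vol k `^ (- 2^-1).

Notation v := corner_vol.
Notation h := corner_haar.
Notation ht := corner_height.
Notation C k := (cube_set R (corner_cube n.+1 k)).

Lemma corner_volE k : v k = ((2^-1) ^+ n.+1) ^+ k.
Proof.
by rewrite /v vol_dcube /= -exprnN -exprVn -!exprM mulnC.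
Qed.

Lemma corner_vol_gt0 k : 0 < v k.
Proof. exact: vol_gt0. Qed.

Lemma corner_height_gt0 k : 0 < ht k.
Proof. by rewrite powR_gt0// corner_vol_gt0. Qed.

(** Stated as a product, so that the polynomial identities below can eliminate
    the square root of the volume. *)
Lemma sqrt_vol_height k : v k `^ 2^-1 * ht k = 1.
Proof.
rewrite -powRD ?(gt_eqF (corner_vol_gt0 _)) ?implybT//.
by rewrite subrr powRr0.
Qed.

Lemma corner_index k : haar_index (corner_cube n.+1 k, eps0 n.+1).
Proof. by apply/eqP => /ffunP/(_ ord0); rewrite !ffunE. Qed.

Lemma dyadic_cornerE k (t : R) :
  dyadic_interval R (- k%:Z) (-1) t <-> - (2^-1) ^+ k <= t < 0.
Proof.
by rewrite dyadic_intervalE addNr mulr0 mulrN1 -exprnN -exprVn.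
Qed.

(** The right half of the interval [[-2^-k, 0)] is the next corner interval:
    this is why coarser Haar functions are positive on finer cubes. *)
Lemma dyadic_corner_right k :
  dyadic_interval R (- k%:Z - 1) (2 * -1 + 1) = dyadic_interval R (- k.+1%:Z) (-1).
Proof. by congr dyadic_interval; lia. Qed.

Lemma dyadic_corner_nested j k (t : R) : (j <= k)%N ->
  dyadic_interval R (- k%:Z) (-1) t -> dyadic_interval R (- j%:Z) (-1) t.
Proof.
move=> jk; rewrite !dyadic_cornerE => /andP[a ->]; rewrite andbT.
by apply: le_trans a; rewrite lerN2 ler_wiXn2l// invf_le1// ler1n.
Qed.

Lemma corner_cubeP k x : C k x <->
  forall i, dyadic_interval R (- k%:Z) (-1) (tnth x i).
Proof. by split=> Cx i; move: (Cx i) => /=; rewrite ffunE. Qed.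

Lemma corner_cube_nested j k x : (j <= k)%N -> C k x -> C j x.
Proof.
move=> jk /corner_cubeP Cx; apply/corner_cubeP => i.
exact: dyadic_corner_nested (Cx i).
Qed.

Lemma corner_haarE k x : C k x ->
  h k x = haar1 false (- k%:Z) (-1) (tnth x ord0) * haar1_height R (- k%:Z) ^+ n.
Proof.
move=> /corner_cubeP Cx; rewrite /h /haar big_ord_recl /= !ffunE; congr (_ * _).
under eq_bigr => i _ do rewrite !ffunE /= haar1_true//.
by rewrite prodr_const card_ord.
Qed.

Lemma corner_heightE k : ht k = haar1_height R (- k%:Z) ^+ n.+1.
Proof. by rewrite (haar_height R (corner_cube n.+1 k)). Qed.

Lemma corner_haar_right k x : C k x ->
  dyadic_interval R (- k.+1%:Z) (-1) (tnth x ord0) -> h k x = ht k.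
Proof.
move=> Cx x0; rewrite corner_haarE// haar1_right ?dyadic_corner_right//.
by rewrite corner_heightE exprS.
Qed.

Lemma corner_haar_coarse j k x : (j < k)%N -> C k x -> h j x = ht j.
Proof.
move=> jk Cx; apply: corner_haar_right; first exact: corner_cube_nested (ltnW jk) Cx.
by move/corner_cubeP : Cx => /(_ ord0); exact: dyadic_corner_nested.
Qed.

Lemma corner_haar_out k x : ~ C k x -> h k x = 0.
Proof. exact: haar_out. Qed.

(** On the left half of a corner cube no finer corner cube is present; this
    makes the function explicitly computable there. *)
Lemma corner_haar_cases k x : C k x -> h k x = ht k \/
  h k x = - ht k /\ forall j, (k < j)%N -> ~ C j x.
Proof.
move=> Cx; move/corner_cubeP : (Cx) => /(_ ord0)/dyadic_halves[xl|xr].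
  right; split=> [|j kj Cj].
    by rewrite corner_haarE// haar1_left// corner_heightE exprS mulNr.
  move/corner_cubeP : Cj => /(_ ord0)/(dyadic_corner_nested kj).
  by rewrite -dyadic_corner_right => /(dyadic_half_disj xl).
by left; apply: corner_haar_right => //; rewrite -dyadic_corner_right.
Qed.

(** Points with nonnegative first coordinate are in no corner cube, and the
    others are at positive distance from the corner. *)
Lemma corner_cube_eventually x : exists K, forall k, (K <= k)%N -> ~ C k x.
Proof.
have [x0|x0] := leP 0 (tnth x ord0).
  exists 0%N => k _ /corner_cubeP/(_ ord0)/dyadic_cornerE/andP[_].
  by rewrite ltNge x0.
have [K xK] : exists K, (2^-1) ^+ K < - tnth x ord0.
  have : (fun k => (2^-1 : R) ^+ k) @ \oo --> (0 : R).
    by apply: cvg_expr; rewrite gtr0_norm// invf_lt1// ltr1n.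
  move=> /cvgrPdist_lt/(_ (- tnth x ord0)); rewrite oppr_gt0 => /(_ x0)[K _ hK].
  by exists K; have := hK K (leqnn _); rewrite /= sub0r normrN ger0_norm.
exists K => k Kk /(corner_cube_nested Kk)/corner_cubeP/(_ ord0)/dyadic_cornerE/andP[].
by lra.
Qed.

Lemma corner_fun_partial alpha x K N : (forall k, (K <= k)%N -> ~ C k x) ->
  (K <= N)%N ->
  \sum_(0 <= k < N) v k `^ alpha * h k x = \sum_(0 <= k < K) v k `^ alpha * h k x.
Proof.
move=> xK KN; rewrite (big_cat_nat (leq0n K) KN)/= [X in _ + X]big1_seq ?addr0//.
move=> k /=; rewrite mem_index_iota => /andP[Kk _].
by rewrite corner_haar_out ?mulr0//; exact: xK.
Qed.

Lemma corner_fun_cvg alpha x :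
  \sum_(0 <= k < N) v k `^ alpha * h k x @[N --> \oo] --> corner_fun alpha x.
Proof.
have [K xK] := corner_cube_eventually x; apply/cvg_ex.
exists (\sum_(0 <= k < K) v k `^ alpha * h k x).
apply: cvg_near_cst; exists K => // N /= KN; exact: corner_fun_partial.
Qed.

Lemma corner_funE alpha x K : (forall k, (K <= k)%N -> ~ C k x) ->
  corner_fun alpha x = \sum_(0 <= k < K) v k `^ alpha * h k x.
Proof.
move=> xK; apply: cvg_lim => //.
apply: cvg_near_cst; exists K => // N /= KN; exact: corner_fun_partial.
Qed.

End Corner.

(** * Finite sums of corner Haar functions *)

Lemma nneseries_geometric_lty (R : realType) (a r : R) : 0 <= a -> 0 < r < 1 ->
  (\sum_(0 <= k <oo) (a * r ^+ k)%:E < +oo)%E.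
Proof.
move=> a0 /andP[r0 r1].
apply: (@le_lt_trans _ _ (a / (1 - r))%:E); last exact: ltry.
apply: lime_le.
  by apply: is_cvg_nneseries => k _ _; rewrite lee_fin mulr_ge0// exprn_ge0// ltW.
apply: nearW => N; rewrite sumEFin lee_fin.
by apply: (geometric_le_lim N a0 r0); rewrite gtr0_norm.
Qed.

Lemma Lfun2_integrable d (T : measurableType d) (R : realType)
    (mu : {measure set T -> \bar R}) (f : T -> R) :
  measurable_fun setT f -> mu.-integrable setT (EFin \o fun x => f x ^+ 2) ->
  f \in Lfun mu 2%:E.
Proof.
move=> mf /integrableP[_ intf]; rewrite inE; apply/andP; split; rewrite inE//=.
rewrite /finite_norm; have two : (2 : R) != 0 by rewrite pnatr_eq0.
apply: (lty_poweRy two); rewrite powR_Lnorm//.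
rewrite (eq_integral (fun x => `|(f x ^+ 2)%:E|%E))// => x _ /=.
by rewrite powR_mulrn// normrX.
Qed.

Lemma integrableZl_EFin d (T : measurableType d) (R : realType)
    (mu : {measure set T -> \bar R}) (c : R) (f : T -> R) :
  mu.-integrable setT (EFin \o f) ->
  mu.-integrable setT (EFin \o fun x => c * f x).
Proof. by move=> intf; exact: (integrableZl measurableT c intf). Qed.

Lemma integrableD_EFin d (T : measurableType d) (R : realType)
    (mu : {measure set T -> \bar R}) (f g : T -> R) :
  mu.-integrable setT (EFin \o f) -> mu.-integrable setT (EFin \o g) ->
  mu.-integrable setT (EFin \o fun x => f x + g x).
Proof. by move=> intf intg; exact: (integrableD measurableT intf intg). Qed.

Section CornerFun.
Context (R : realType) (n : nat).
Implicit Types (k j m N : nat) (x : Rn R n.+1) (c : nat -> R).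

Notation v := (corner_vol R n).
Notation h := (@corner_haar R n).
Notation C k := (cube_set R (corner_cube n.+1 k)).
Notation mu := (leb R n.+1).

Definition corner_sum c N x : R := \sum_(0 <= k < N) c k * h k x.

Lemma corner_sumS c N x : corner_sum c N.+1 x = corner_sum c N x + c N * h N x.
Proof. by rewrite /corner_sum big_nat_recr. Qed.

Lemma integrable_corner_sum c N : mu.-integrable setT (EFin \o corner_sum c N).
Proof.
elim: N => [|N IH].
  have -> : EFin \o corner_sum c 0 = cst 0%E.
    by apply/funext => x; rewrite /= /corner_sum big_nil.
  exact: integrable0.
have -> : EFin \o corner_sum c N.+1 =
    ((EFin \o corner_sum c N) \+ (fun x => (c N)%:E * (EFin \o h N) x))%E.
  by apply/funext => x; rewrite /= corner_sumS.
by apply: integrableD => //; apply: integrableZl => //; exact: integrable_haar.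
Qed.

Lemma measurable_corner_sum c N : measurable_fun setT (corner_sum c N).
Proof. by apply/measurable_EFinP; case/integrableP: (integrable_corner_sum c N). Qed.

Lemma inner_corner_sum c N Q e :
  inner (corner_sum c N) (haar Q e) = \sum_(0 <= k < N) c k * inner (h k) (haar Q e).
Proof.
elim: N => [|N IH].
  rewrite big_nil /inner; under eq_Rintegral => x _.
    rewrite /corner_sum big_nil mul0r; over.
  by rewrite Rintegral_cst ?mul0r.
rewrite big_nat_recr//= -IH /inner.
under eq_Rintegral do rewrite corner_sumS mulrDl -mulrA.
have ihh := integrableM_haar Q e (integrable_haar R (corner_cube n.+1 N) (eps0 n.+1)).
rewrite RintegralD//; first by congr (_ + _); rewrite RintegralZl.
  exact/integrableM_haar/integrable_corner_sum.
exact: integrableZl_EFin.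
Qed.

Lemma inner_corner_haar k p : haar_index p ->
  inner (h k) (haar p.1 p.2) = (p == (corner_cube n.+1 k, eps0 n.+1))%:R.
Proof.
case: p => Q e he /=; case: eqP => [[-> ->]|ne]; first exact: inner_haar_sqr.
apply: inner_haar_neq => //; first exact: corner_index.
by move=> E; apply: ne; rewrite E.
Qed.

Lemma corner_cube_inj : injective (corner_cube n.+1).
Proof. by move=> j k [] /eqP; rewrite eqr_opp => /eqP []. Qed.

Lemma inner_corner_sum_corner c N j :
  inner (corner_sum c N) (h j) = if (j < N)%N then c j else 0.
Proof.
rewrite inner_corner_sum; under eq_bigr => k _.
  rewrite (inner_corner_haar k (corner_index n j)).
  have -> : ((corner_cube n.+1 j, eps0 n.+1) == (corner_cube n.+1 k, eps0 n.+1))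
     = (k == j).
    by apply/eqP/eqP => [[/eqP]|->//]; rewrite eqr_opp => /eqP[].
  over.
case: ltnP => [jN|Nj].
  rewrite (bigD1_seq j) ?mem_index_iota ?iota_uniq//= eqxx mulr1 big1 ?addr0//.
  by move=> k /negbTE ->; rewrite mulr0.
rewrite big1_seq// => k /=; rewrite mem_index_iota => /andP[_ kN].
by rewrite (ltn_eqF (leq_trans kN Nj)) mulr0.
Qed.

(** Pythagoras: expanding the square of one more summand, the mixed term is
    integrated away by orthogonality. *)
Lemma corner_sum_sqr c N :
  mu.-integrable setT (EFin \o fun x => corner_sum c N x ^+ 2) /\
  \int[mu]_x (corner_sum c N x ^+ 2) = \sum_(0 <= k < N) c k ^+ 2.
Proof.
elim: N => [|N [intN valN]].
  have E : (fun x => corner_sum c 0 x ^+ 2) = cst 0.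
    by apply/funext => x; rewrite /corner_sum big_nil expr0n.
  split; last by rewrite E big_nil Rintegral_cst ?mul0r.
  by rewrite E; exact: integrable0.
have intNh := integrableM_haar (corner_cube n.+1 N) (eps0 n.+1)
  (integrable_corner_sum c N).
have inthh := integrableM_haar (corner_cube n.+1 N) (eps0 n.+1)
  (integrable_haar R (corner_cube n.+1 N) (eps0 n.+1)).
pose u x := 2 * c N * (corner_sum c N x * h N x).
pose w x := c N ^+ 2 * (h N x * h N x).
have E : (fun x => corner_sum c N.+1 x ^+ 2) =
    (fun x => corner_sum c N x ^+ 2 + u x + w x).
  by apply/funext => x; rewrite corner_sumS /u /w; ring.
have intu : mu.-integrable setT (EFin \o u) by exact: integrableZl_EFin.
have intw : mu.-integrable setT (EFin \o w) by exact: integrableZl_EFin.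
have intNu : mu.-integrable setT (EFin \o fun x => corner_sum c N x ^+ 2 + u x).
  exact: integrableD_EFin.
split; first by rewrite E; exact: integrableD_EFin.
rewrite E RintegralD// RintegralD// valN big_nat_recr//= /u /w.
rewrite RintegralZl// RintegralZl//.
have := inner_corner_sum_corner c N N; rewrite ltnn /inner => ->.
have := inner_haar_sqr R (corner_cube n.+1 N) (eps0 n.+1); rewrite /inner => ->.
by rewrite mulr0 addr0 mulr1.
Qed.

End CornerFun.

(** * The function and its Haar coefficients *)

Section CornerFunL2.
Context (R : realType) (n : nat) (alpha : R) (alpha_gt0 : 0 < alpha).
Implicit Types (k j m N : nat) (x : Rn R n.+1).

Notation v := (corner_vol R n).
Notation h := (@corner_haar R n).
Notation mu := (leb R n.+1).
Notation c := (fun k => v k `^ alpha).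
Notation f := (@corner_fun R n.+1 alpha).

Lemma corner_vol_powR a k : v k `^ a = (((2^-1) ^+ n.+1) `^ a) ^+ k.
Proof.
by rewrite corner_volE -powR_mulrn ?exprn_ge0// -powRrM mulrC powRrM powR_mulrn// powR_ge0.
Qed.

Lemma corner_ratio_powR_itv a : 0 < a -> 0 < ((2^-1 : R) ^+ n.+1) `^ a < 1.
Proof.
move=> a0; rewrite powR_gt0 ?exprn_gt0//=.
rewrite [ltRHS](_ : 1 = 1 `^ a); last by rewrite powR1.
rewrite gt0_ltr_powR ?nnegrE ?exprn_ge0//.
by rewrite exprn_ilt1// invf_lt1// ltr1n.
Qed.

Lemma corner_sum_cvg x : corner_sum c N x @[N --> \oo] --> f x.
Proof. exact: corner_fun_cvg. Qed.

Lemma measurable_corner_fun : measurable_fun setT f.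
Proof.
apply: (measurable_fun_cvg (fun N => @measurable_corner_sum R n c N)) => x _.
exact: corner_sum_cvg.
Qed.

(** By Fatou, the integral of the square is bounded by the limit of the integrals
    for the partial sums, which form a convergent geometric series. *)
Lemma integrable_corner_fun_sqr :
  mu.-integrable setT (EFin \o fun x => f x ^+ 2).
Proof.
pose g N x := (corner_sum c N x ^+ 2)%:E.
have mg N : measurable_fun setT (g N).
  by apply/measurable_EFinP/measurable_funX; exact: measurable_corner_sum.
have g0 N x : setT x -> (0 <= g N x)%E by rewrite lee_fin sqr_ge0.
apply/integrableP; split.
  by apply/measurable_EFinP/measurable_funX; exact: measurable_corner_fun.
rewrite [ltLHS](_ : _ = \int[mu]_x limn_einf (g ^~ x))%E; last first.
  apply: eq_integral => x _ /=; rewrite ger0_norm ?sqr_ge0//.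
  have : g N x @[N --> \oo] --> (f x ^+ 2)%:E.
    apply: cvg_EFin; first exact: nearW.
    exact: (cvgM (@corner_sum_cvg x) (@corner_sum_cvg x)).
  by move=> /cvg_limn_einf_sup[->].
apply: le_lt_trans (fatou mu measurableT mg g0) _.
pose r : R := ((2^-1) ^+ n.+1) `^ (alpha + alpha).
have /andP[r0 r1] : 0 < r < 1 by apply: corner_ratio_powR_itv; rewrite addr_gt0.
have cvgI : (\int[mu]_x g N x @[N --> \oo] --> (1 / (1 - r))%:E)%E.
  have vI N : (\int[mu]_x g N x = (\sum_(0 <= k < N) (v k `^ alpha) ^+ 2)%:E)%E.
    have [intN <-] := @corner_sum_sqr R n c N.
    by rewrite /Rintegral fineK//; exact: integrable_fin_num.
  rewrite (funext vI).
  have cvgS : \sum_(0 <= k < N) (v k `^ alpha) ^+ 2 @[N --> \oo] --> 1 / (1 - r).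
    rewrite (_ : (fun N => _) = series (geometric 1 r)).
      by apply: cvg_geometric_series; rewrite gtr0_norm.
    apply/funext => N; rewrite /series/=; apply: eq_bigr => k _.
    rewrite mul1r /r -corner_vol_powR expr2 -powRD//.
    by rewrite (gt_eqF (corner_vol_gt0 _ _ _)) implybT.
  by apply: cvg_EFin; [exact: nearW|exact: cvgS].
by have [-> _] := cvg_limn_einf_sup cvgI; rewrite ltry.
Qed.

Lemma corner_fun_Lfun : f \in Lfun mu 2%:E.
Proof.
exact: Lfun2_integrable measurable_corner_fun integrable_corner_fun_sqr.
Qed.

(** This identity gives the [L^1] norm of [h k] from its [L^2] norm. *)
Lemma corner_haar_norm k x : `|h k x| = v k `^ 2^-1 * (h k x * h k x).
Proof.
have sE := sqrt_vol_height R n k.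
have [Cx|nCx] := pselect (cube_set R (corner_cube n.+1 k) x); last first.
  by rewrite corner_haar_out// normr0 !mulr0.
have p := corner_height_gt0 R n k.
have [->|[-> _]] := corner_haar_cases Cx.
  by rewrite gtr0_norm// mulrA sE mul1r.
by rewrite normrN gtr0_norm// mulrNN mulrA sE mul1r.
Qed.

(** Dominated convergence.  A Haar function is bounded, and the sum of the
    [v_k^alpha |h_k|] is integrable, the [L^1] norms of its terms being
    [v_k^(alpha + 1/2)]. *)
Lemma inner_corner_sum_cvg Q e :
  mu.-integrable setT (EFin \o fun x => f x * haar Q e x) /\
  inner (corner_sum c N) (haar Q e) @[N --> \oo] --> inner f (haar Q e).
Proof.
have [b b0 hb] : exists2 b : R, 0 <= b & forall x, `|haar Q e x| <= b.
  by exists (vol R Q `^ (- 2^-1)); [exact: powR_ge0|exact: haar_bound].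
pose G k x := (b * v k `^ (alpha + 2^-1) * (h k x * h k x))%:E.
have intG k : mu.-integrable setT (G k).
  by apply: integrableZl_EFin; apply: integrableM_haar; exact: integrable_haar.
have mG k : measurable_fun setT (G k) by case/integrableP: (intG k).
have G0 k x : (0 <= G k x)%E.
  rewrite lee_fin; apply: mulr_ge0; last by rewrite -expr2 sqr_ge0.
  exact: mulr_ge0 b0 (powR_ge0 _ _).
have vG k : (\int[mu]_x G k x = (b * v k `^ (alpha + 2^-1))%:E)%E.
  rewrite -[LHS]fineK; last exact: integrable_fin_num.
  congr EFin; transitivity (b * v k `^ (alpha + 2^-1) * inner (h k) (h k)).
    by apply: RintegralZl => //; apply: integrableM_haar; exact: integrable_haar.
  by rewrite inner_haar_sqr mulr1.
pose g x := (\sum_(0 <= k <oo) G k x)%E.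
have mg : measurable_fun setT g.
  have -> : g = fun x => (\sum_(0 <= k <oo | k \in xpredT) G k x)%E.
    by apply/funext => x; exact: eq_eseriesl.
  exact: ge0_emeasurable_sum.
have intg : mu.-integrable setT g.
  apply/integrableP; split => //.
  under eq_integral => x _.
    rewrite gee0_abs; last by apply: nneseries_ge0 => k _ _; exact: G0.
    over.
  rewrite integral_nneseries//; under eq_eseriesr do rewrite vG corner_vol_powR.
  by apply: nneseries_geometric_lty => //; apply: corner_ratio_powR_itv; rewrite addr_gt0.
pose F N x := (corner_sum c N x * haar Q e x)%:E.
have intF N : mu.-integrable setT (F N).
  by apply: integrableM_haar; exact: integrable_corner_sum.
have mF N : measurable_fun setT (F N) by case/integrableP: (intF N).
have FG N x : (`|F N x| <= g x)%E.
  apply: (@le_trans _ _ (\sum_(0 <= k < N) G k x)%E); last first.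
    by apply: nneseries_lim_ge => k _ _; exact: G0.
  rewrite sumEFin lee_fin normrM mulrC.
  apply: (@le_trans _ _ (b * `|corner_sum c N x|)).
    by rewrite ler_wpM2r.
  apply: (@le_trans _ _ (b * \sum_(0 <= k < N) `|v k `^ alpha * h k x|)).
    by rewrite ler_wpM2l// ler_norm_sum.
  rewrite mulr_sumr; apply: ler_sum => k _.
  rewrite normrM ger0_norm ?powR_ge0// corner_haar_norm mulrA [X in _ <= X]mulrA.
  rewrite powRD ?(gt_eqF (corner_vol_gt0 _ _ _)) ?implybT//.
  by rewrite !mulrA.
have cvgF x : setT x -> F N x @[N --> \oo] --> (f x * haar Q e x)%:E.
  move=> _; apply: cvg_EFin; first exact: nearW.
  by apply: cvgMl; exact: corner_sum_cvg.
have mf : measurable_fun setT (fun x => (f x * haar Q e x)%:E).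
  apply/measurable_EFinP/measurable_funM; first exact: measurable_corner_fun.
  exact: measurable_haar.
have [intf _ cvgI] := dominated_convergence measurableT mF mf
  (aeW mu cvgF) intg (aeW mu (fun x N _ => FG N x)).
split => //; rewrite /inner /Rintegral; apply: fine_cvg.
by rewrite fineK//; exact: integrable_fin_num.
Qed.

Lemma inner_corner_fun_corner j : inner f (h j) = v j `^ alpha.
Proof.
have [_ cvgI] := inner_corner_sum_cvg (corner_cube n.+1 j) (eps0 n.+1).
apply: (cvg_unique _ cvgI) => //.
apply: cvg_near_cst; exists j.+1 => // N /= jN.
by rewrite inner_corner_sum_corner jN.
Qed.

Lemma inner_corner_fun_other p : haar_index p ->
  (forall k, p <> (corner_cube n.+1 k, eps0 n.+1)) -> inner f (haar p.1 p.2) = 0.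
Proof.
move=> hp np; have [_ cvgI] := inner_corner_sum_cvg p.1 p.2.
apply: (cvg_unique _ cvgI) => //.
apply: cvg_near_cst; apply: nearW => N.
rewrite inner_corner_sum big1// => k _.
by rewrite inner_corner_haar//; case: eqP => [/np//|_]; rewrite mulr0.
Qed.

End CornerFunL2.

(** * The lower bound for the coefficients of the square *)

(** The next three statements are the algebra of the lower bound.  Here [F] is a
    value of the function, [c] the constant contributed by the coarser cubes, [A]
    the contribution [V * H] of the current cube, [H] the height of its Haar
    function and [S = 1 / H] the square root of its volume. *)
Lemma sqr_haar_value (R : realFieldType) (c V S H : R) : S * H = 1 ->
  2 * V * c <= 2 * (c + V * H) * V + - 2 * (V * H) ^+ 2 * S.
Proof.
move=> SH; rewrite le_eqVlt; apply/orP; left; apply/eqP.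
rewrite [X in _ = _ + X](_ : _ = - 2 * V ^+ 2 * H * (S * H)); last by ring.
by rewrite SH; ring.
Qed.

(** On the right half, Jensen in pointwise form: [F^2] lies above its tangent
    line [2 b F - b^2] at the mean value [b = c + A].  The
    terms in [2 A^2] cancel on the right half and add up to [- 4 A^2 H] on the
    left half, where the tangent bound has to be corrected. *)
Lemma sqr_haar_ge_right (R : realFieldType) (F c A S H : R) :
  S * H = 1 -> 0 <= H ->
  2 * (c + A) * (F * H) + (2 * A ^+ 2 - (c + A) ^+ 2) * H
    + (- 2 * A ^+ 2 * S) * (H * H) <= F ^+ 2 * H.
Proof.
move=> SH H0; have := mulr_ge0 (sqr_ge0 (F - (c + A))) H0.
rewrite [X in _ + X <= _](_ : _ = - 2 * A ^+ 2 * (S * H) * H); last by ring.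
by rewrite SH -[_ <= F ^+ 2 * H]subr_ge0; congr (0 <= _); ring.
Qed.

(** On the left half [F = c - A] is known exactly and equality holds. *)
Lemma sqr_haar_ge_left (R : realFieldType) (c A S H : R) :
  S * H = 1 ->
  2 * (c + A) * ((c - A) * - H) + (2 * A ^+ 2 - (c + A) ^+ 2) * - H
    + (- 2 * A ^+ 2 * S) * (- H * - H) <= (c - A) ^+ 2 * - H.
Proof.
move=> SH; rewrite le_eqVlt; apply/orP; left; apply/eqP.
rewrite [X in _ + X = _](_ : _ = - 2 * A ^+ 2 * (S * H) * H); last by ring.
by rewrite SH; ring.
Qed.

Section CornerFunSqr.
Context (R : realType) (n : nat) (alpha : R) (alpha_gt0 : 0 < alpha).
Implicit Types (k j m N : nat) (x : Rn R n.+1).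

Notation v := (corner_vol R n).
Notation h := (@corner_haar R n).
Notation ht := (corner_height R n).
Notation mu := (leb R n.+1).
Notation f := (@corner_fun R n.+1 alpha).
Notation a := (fun k => v k `^ alpha * ht k).
Notation c := (fun m => \sum_(0 <= j < m) v j `^ alpha * ht j).

Lemma corner_fun_left m x : cube_set R (corner_cube n.+1 m) x ->
  (forall j, (m < j)%N -> ~ cube_set R (corner_cube n.+1 j) x) ->
  h m x = - ht m -> f x = c m - a m.
Proof.
move=> Cx nC hx; rewrite (@corner_funE R n alpha x m.+1)//.
rewrite (big_nat_recr _ _ _ (leq0n m)) hx /=; congr (_ + _); last exact: mulrN.
by apply: eq_big_nat => j /andP[_ jm]; rewrite (corner_haar_coarse jm Cx).
Qed.

(** The bound is linear in the function, the coarse part being a constant; its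
    integral therefore only involves known Haar coefficients. *)
Lemma corner_fun_sqr_haar_ge m x :
  2 * (c m + a m) * (f x * h m x) + (2 * a m ^+ 2 - (c m + a m) ^+ 2) * h m x
    + (- 2 * a m ^+ 2 * v m `^ 2^-1) * (h m x * h m x) <= f x ^+ 2 * h m x.
Proof.
have [Cx|nCx] := pselect (cube_set R (corner_cube n.+1 m) x); last first.
  by rewrite corner_haar_out// !mulr0 !addr0.
have SH := sqrt_vol_height R n m; have H0 := ltW (corner_height_gt0 R n m).
have [hx|[hx nC]] := corner_haar_cases Cx; rewrite hx.
  exact: (sqr_haar_ge_right (f x) (c m) (a m) SH H0).
rewrite (corner_fun_left Cx nC hx).
exact: (sqr_haar_ge_left (c m) (a m) SH).
Qed.

Lemma inner_corner_fun_sqr_ge m :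
  2 * v m `^ alpha * c m <= inner (fun x => f x ^+ 2) (h m).
Proof.
set b := c m + a m.
have int2 := integrableM_haar (corner_cube n.+1 m) (eps0 n.+1)
  (integrable_corner_fun_sqr n alpha_gt0).
have [intfh _] := inner_corner_sum_cvg alpha_gt0 (corner_cube n.+1 m) (eps0 n.+1).
have inth := integrable_haar R (corner_cube n.+1 m) (eps0 n.+1).
have inthh := integrableM_haar (corner_cube n.+1 m) (eps0 n.+1) inth.
have i1 := integrableZl_EFin (2 * b) intfh.
have i2 := integrableZl_EFin (2 * a m ^+ 2 - b ^+ 2) inth.
have i3 := integrableZl_EFin (- 2 * a m ^+ 2 * v m `^ 2^-1) inthh.
have i12 := integrableD_EFin i1 i2.
have i123 := integrableD_EFin i12 i3.
apply: le_trans (le_Rintegral measurableT i123 int2 _); last first.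
  by move=> x _; exact: corner_fun_sqr_haar_ge.
rewrite RintegralD// RintegralD// RintegralZl// RintegralZl// RintegralZl//.
have -> : \int[mu]_x (f x * haar (corner_cube n.+1 m) (eps0 n.+1) x) = v m `^ alpha.
  exact: inner_corner_fun_corner.
have -> : \int[mu]_x haar (corner_cube n.+1 m) (eps0 n.+1) x = 0.
  by apply: Rintegral_haar; exact: corner_index.
have -> : \int[mu]_x (haar (corner_cube n.+1 m) (eps0 n.+1) x *
    haar (corner_cube n.+1 m) (eps0 n.+1) x) = 1.
  exact: inner_haar_sqr.
rewrite mulr0 addr0 mulr1.
exact: (sqr_haar_value (c m) (v m `^ alpha) (sqrt_vol_height R n m)).
Qed.

End CornerFunSqr.

(** * Energies *)

(** With [u = v_m], [rho * u = v_(m+1)] and [w = - 2 s / n], the right-hand side is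
    the lower bound for the term of index [m + 1] of the energy of the square.
    It equals the left-hand side times a nonpositive power of [u <= 1]. *)
Lemma powR_energy_ge (R : realType) (rho u w a : R) : 0 < rho -> 0 < u ->
  u <= 1 -> w + 4 * a - 1 <= 0 ->
  4 * rho `^ (w + 2 * a) <=
  (rho * u) `^ w * (2 * (rho * u) `^ a * u `^ (a - 2^-1)) ^+ 2.
Proof.
move=> rho0 u0 u1 expo.
have -> : (rho * u) `^ w * (2 * (rho * u) `^ a * u `^ (a - 2^-1)) ^+ 2 =
    4 * rho `^ (w + 2 * a) * u `^ (w + 4 * a - 1).
  rewrite !powRM ?ltW//.
  rewrite (_ : w + 4 * a - 1 = w + a + a + (a - 2^-1) + (a - 2^-1)); last by lra.
  rewrite (_ : w + 2 * a = w + a + a); last by ring.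
  rewrite ![_ `^ (w + a + a)]powRD ?(gt_eqF rho0) ?implybT//.
  rewrite ![_ `^ (w + a)]powRD ?(gt_eqF rho0) ?implybT//.
  rewrite [u `^ (_ + (_ + _))]powRD ?(gt_eqF u0) ?implybT//.
  rewrite [u `^ (w + _ + _ + (_ + _))]powRD ?(gt_eqF u0) ?implybT//.
  rewrite [u `^ (w + _ + _)]powRD ?(gt_eqF u0) ?implybT//.
  rewrite [u `^ (w + _)]powRD ?(gt_eqF u0) ?implybT//.
  by ring.
rewrite ler_peMr ?mulr_ge0 ?powR_ge0//.
by rewrite -[leLHS](powRr0 u) ger_powR// u0.
Qed.

Section Energy.
Context (R : realType) (n : nat) (s : R).
Implicit Types (k j m N : nat) (g : Rn R n.+1 -> R).
Notation v := (corner_vol R n).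
Notation h := (@corner_haar R n).

Let w : R := - (2 * s / n.+1%:R).
Let energy_term g (p : dcube n.+1 * {ffun 'I_n.+1 -> bool}) :=
  (vol R p.1 `^ w * `|inner g (haar p.1 p.2)| ^+ 2)%:E.
Let corner_p k : dcube n.+1 * {ffun 'I_n.+1 -> bool} := (corner_cube n.+1 k, eps0 n.+1).

Let energy_term_ge0 g p : (0 <= energy_term g p)%E.
Proof. by rewrite lee_fin mulr_ge0// ?powR_ge0// sqr_ge0. Qed.

(** Separating the corner cubes turns the relevant part of the energy into an
    ordinary series. *)
Lemma dyadic_energy_corner g : dyadic_energy s g =
  (\sum_(0 <= k <oo) (v k `^ w * `|inner g (h k)| ^+ 2)%:E +
   \esum_(p in haar_index (n := n.+1) `&` ~` range corner_p) energy_term g p)%E.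
Proof.
rewrite /dyadic_energy (esumID (range corner_p)); last by move=> p _; exact: energy_term_ge0.
congr (_ + _)%E.
rewrite (_ : _ `&` _ = range corner_p); last first.
  by apply/seteqP; split=> [p []//|p [k _ <-]]; split=> //; exact: corner_index.
rewrite (reindex_esum setT _ corner_p); last first.
  by apply/inj_bij => j k _ _ /(congr1 fst)/corner_cube_inj.
rewrite -nneseries_esumT// => k; exact: energy_term_ge0.
Qed.

Lemma corner_fun_energy (alpha : R) : 0 < alpha -> s / n.+1%:R < alpha ->
  (dyadic_energy s (@corner_fun R n.+1 alpha) < +oo)%E.
Proof.
move=> alpha0 s_alpha; rewrite dyadic_energy_corner esum1 ?adde0; last first.
  move=> p [hp np]; rewrite /energy_term (inner_corner_fun_other alpha0 hp).
    by rewrite normr0 expr0n mulr0.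
  by move=> k pk; apply: np; exists k.
under eq_eseriesr => k _.
  rewrite (inner_corner_fun_corner n alpha0) ger0_norm ?powR_ge0// expr2.
  rewrite -!powRD ?(gt_eqF (corner_vol_gt0 _ _ _)) ?implybT//.
  rewrite corner_vol_powR -[X in X%:E]mul1r.
  over.
apply: nneseries_geometric_lty => //; apply: corner_ratio_powR_itv.
by rewrite /w; move: s_alpha; rewrite -mulrA; set t := s / _ => ?; lra.
Qed.

Local Notation corner_sqr alpha := (fun x => (@corner_fun R n.+1 alpha x ^+ 2)%R).

Lemma corner_fun_sqr_energy (alpha : R) : 0 < alpha ->
  alpha < s / (2 * n.+1%:R) + 1 / 4 ->
  ~ (dyadic_energy s (corner_sqr alpha) < +oo)%E.
Proof.
move=> alpha0 alpha_s.
pose rho : R := (2^-1) ^+ n.+1.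
have rho0 : 0 < rho by rewrite exprn_gt0.
pose kappa := 4 * rho `^ (w + 2 * alpha).
have kappa0 : 0 < kappa by rewrite mulr_gt0// powR_gt0.
have expo : w + 4 * alpha - 1 <= 0.
  by rewrite /w; move: alpha_s; rewrite invfM; set t := n.+1%:R^-1; lra.
have term m : kappa <= v m.+1 `^ w * `|inner (corner_sqr alpha) (h m.+1)| ^+ 2.
  have v0 := corner_vol_gt0 R n m.
  have vS : v m.+1 = rho * v m by rewrite !corner_volE exprS.
  have v1 : v m <= 1 by rewrite corner_volE exprn_ile1// exprn_ile1// invf_le1// ler1n.
  have lb : 2 * v m.+1 `^ alpha * v m `^ (alpha - 2^-1) <=
      inner (corner_sqr alpha) (h m.+1).
    apply: le_trans (inner_corner_fun_sqr_ge n alpha0 m.+1).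
    apply: ler_wpM2l; first by rewrite mulr_ge0 ?powR_ge0.
    (* Only the last term of the sum over the coarser cubes is kept. *)
    rewrite (big_nat_recr _ _ _ (leq0n m)) /=.
    have -> : v m `^ (alpha - 2^-1) = v m `^ alpha * corner_height R n m.
      by rewrite powRD// (gt_eqF v0) implybT.
    rewrite lerDr; apply: sumr_ge0 => j _.
    exact: mulr_ge0 (powR_ge0 _ _) (ltW (corner_height_gt0 _ _ _)).
  have := powR_energy_ge rho0 v0 v1 expo; rewrite -vS => /le_trans; apply.
  apply: ler_wpM2l; first exact: powR_ge0.
  rewrite ler_sqr ?nnegrE//; first exact: le_trans lb (ler_norm _).
  by rewrite mulr_ge0 ?mulr_ge0 ?powR_ge0.
rewrite dyadic_energy_corner => /(le_lt_trans (leeDl _ _)) fin.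
have {}fin := fin (esum_ge0 (fun p _ => energy_term_ge0 _ p)).
move: fin; set E := (X in (X < _)%E) => fin.
(* The first term of the series is dropped: [term] starts at index 1, as the
   largest cube has no coarser one. *)
have E_ge N : ((kappa *+ N)%:E <= E)%E.
  apply: (@le_trans _ _ (\sum_(0 <= k < N.+1) (v k `^ w *
      `|inner (corner_sqr alpha) (h k)| ^+ 2)%:E)%E); last first.
    by apply: nneseries_lim_ge => k _ _; exact: (energy_term_ge0 _ (corner_p k)).
  rewrite sumEFin lee_fin (big_nat_recl _ _ _ (leq0n N)) /=.
  rewrite -[leLHS]add0r; apply: lerD; first by rewrite mulr_ge0 ?powR_ge0// sqr_ge0.
  by rewrite -[in leLHS](subn0 N) -sumr_const_nat; apply: ler_sum => k _; exact: term.
have E0 := E_ge 0%N; have Efin : E \is a fin_num by rewrite ge0_fin_numE.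
have q0 : 0 <= fine E / kappa by apply: divr_ge0; [exact: fine_ge0|exact: ltW].
have := archi_boundP q0; rewrite ltr_pdivrMr// mulr_natl ltNge => /negP; apply.
by rewrite -lee_fin fineK.
Qed.

End Energy.

Theorem proposition12 (R : realType) (n : nat) (s : R)
    (n_gt0 : (0 < n)%N) (s_gt0 : 0 < s) (s_lt : s < n%:R / 2) :
  ~ is_algebra (@dyadic_sobolev R n s) /\
  (forall alpha : R,
     s / n%:R < alpha -> alpha < s / (2 * n%:R) + 1 / 4 ->
     @dyadic_sobolev R n s (@corner_fun R n alpha) /\
     ~ @dyadic_sobolev R n s (fun x => @corner_fun R n alpha x ^+ 2)).
Proof.
case: n n_gt0 s_lt => // n _ s_lt.
have n0 : 0 < n.+1%:R :> R by rewrite ltr0n.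
have main (alpha : R) :
    s / n.+1%:R < alpha -> alpha < s / (2 * n.+1%:R) + 1 / 4 ->
    @dyadic_sobolev R n.+1 s (@corner_fun R n.+1 alpha) /\
    ~ @dyadic_sobolev R n.+1 s (fun x => @corner_fun R n.+1 alpha x ^+ 2).
  move=> lo hi; have alpha0 : 0 < alpha by apply: lt_trans lo; rewrite divr_gt0.
  split; first by split; [exact: corner_fun_Lfun|exact: corner_fun_energy].
  by move=> [_]; exact: corner_fun_sqr_energy.
split=> // alg.
pose t := s / n.+1%:R.
have t_lt : t < 1 / 2 by rewrite /t ltr_pdivrMr//; lra.
have half : s / (2 * n.+1%:R) = t / 2 by rewrite /t [2 * _]mulrC invfM mulrA.
(* The midpoint between t and t / 2 + 1 / 4, which are in the right order exactly
   when t < 1 / 2, that is, s < n / 2. *)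
pose alpha := (t + (t / 2 + 1 / 4)) / 2.
have [|| inH ninH] := main alpha; rewrite ?half -/t /alpha; [lra|lra|].
apply: ninH; rewrite (_ : (fun x => _) = @corner_fun R n.+1 alpha \* @corner_fun R n.+1 alpha).
  exact: alg.
by apply/funext => x; rewrite /= expr2.
Qed.
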